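(* Let $\mathcal{H}$ be a separable Hilbert space and let $$\mathcal{E}(\mathcal{H})=\left\{T\in B(\mathcal{H}): \{T^k\phi\}_{k\in \mathbb{N}_0}\ \text{is a frame for}\ \mathcal{H}\ \text{for some}\ \phi \in \mathcal{H} \right\}.$$ Then the set of invertible operators in $\mathcal{E}(\mathcal{H})$ is relatively open in $\mathcal{E}(\mathcal{H})$ (with respect to the operator norm topology).
   Context: $B(\mathcal{H})$ is the set of bounded linear operators on $\mathcal{H}$ with the operator norm; $\mathbb{N}_0=\{0,1,2,\dots\}$. A sequence $\{g_k\}$ in $\mathcal{H}$ is a frame for $\mathcal{H}$ if there exist constants $A,B>0$ such that $A\|f\|^2\le\sum_{k}|\langle f,g_k\rangle|^2\le B\|f\|^2$ for all $f\in\mathcal{H}$. *)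

(* Defs.v *)
From HB Require Import structures.
From mathcomp Require Import all_boot all_order all_algebra.
From mathcomp Require Import sesquilinear complex.
From mathcomp Require Import all_classical all_reals all_analysis.

Set Implicit Arguments.
Unset Strict Implicit.
Unset Printing Implicit Defensive.

Import Order.TTheory GRing.Theory Num.Theory.
Import numFieldNormedType.Exports.

Local Open Scope classical_set_scope.
Local Open Scope ring_scope.

(* Hilbert spaces over both R and C are covered.  In C the order of MathComp is
   partial: x <= y means that y - x is a nonnegative real. *)
Inductive scalar_kind := RealScalars | ComplexScalars.

Definition scalar_field (R : realType) (k : scalar_kind) : numFieldType :=
  match k with
  | RealScalars => R
  | ComplexScalars => R[i]%C
  end.

Definition scalar_conj (R : realType) (k : scalar_kind) :
    scalar_field R k -> scalar_field R k :=
  match k with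
  | RealScalars => idfun
  | ComplexScalars => @Num.conj R[i]%C
  end.
Arguments scalar_conj : clear implicits.

Definition separable (X : topologicalType) :=
  exists2 D : set X, countable D & dense D.

Section operators.
Context {R : realType} {k : scalar_kind}.
Local Notation K := (scalar_field R k).

Lemma supremum_scalar (A : set K) (M : K) : A !=set0 ->
  (forall a, A a -> 0 <= a) -> (forall a, A a -> a <= M) ->
  (forall a, A a -> a <= supremum 0 A) /\
  (forall b, (forall a, A a -> a <= b) -> supremum 0 A <= b).
Proof.
move=> A0 Age0 AM.
suff [s [sub slub]] : exists s, supremums A s.
  rewrite /supremum; case: ifPn => [/eqP A00|_].
    by move: A0; rewrite A00 => -[].
  by case: xgetP => [x _ []|/(_ s)[]].
move: A M A0 Age0 AM; rewrite /scalar_field; case: k => A M [a0 Aa0] Age0 AM.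
  have hA : has_sup A by split; [exists a0 | exists M].
  exists (sup A); split=> [a Aa|b Ab]; first exact: sup_upper_bound.
  by apply: ge_sup => //; exists a0.
pose B := [set complex.Re a | a in A].
have AE a : A a -> a = (complex.Re a)%:C%C.
  by case: a => x y /Age0; rewrite lecE/= => /andP[/eqP-> _].
have hB : has_sup B.
  split; first by exists (complex.Re a0), a0.
  exists (complex.Re M) => _ [a /AM + <-].
  by case: a M {AM} => ? ? [? ?]; rewrite lecE => /andP[].
exists ((sup B)%:C)%C; split=> [a Aa|b Ab].
  rewrite (AE _ Aa) lecR; apply: sup_upper_bound => //; by exists a.
have bge0 : 0 <= b by rewrite (le_trans (Age0 _ Aa0)) ?Ab.
have bE : b = (complex.Re b)%:C%C.
  by move: bge0; case: b {Ab} => x y; rewrite lecE/= => /andP[/eqP-> _].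
rewrite bE lecR; apply: ge_sup; first by case: hB.
by move=> _ [a Aa <-]; have := Ab _ Aa; rewrite bE (AE _ Aa) lecR.
Qed.

Variable H : normedModType K.

Definition bounded_linear : {pred H -> H} := fun T =>
  `[< linear T /\ exists M : K, forall x, `|T x| <= M * `|x| >].

Lemma bounded_linear_submod_closed : submod_closed bounded_linear.
Proof.
split.
  apply/asboolP; split=> [a x y|].
    by change ((0 : H) = a *: (0 : H) + 0); rewrite scaler0 addr0.
  by exists 0 => x; rewrite mul0r (_ : (0 : H -> H) x = 0)// normr0.
move=> a S T /asboolP[lS [M SM]] /asboolP[lT [N TN]]; apply/asboolP; split.
  move=> b x y; rewrite !fctE lS lT !scalerDr !scalerA (mulrC a b).
  by rewrite addrACA.
exists (`|a| * M + N) => x; rewrite !fctE.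
rewrite (le_trans (ler_normD _ _))// mulrDl lerD// normrZ -mulrA.
by rewrite ler_wpM2l.
Qed.

HB.instance Definition _ := GRing.isSubmodClosed.Build _ _ bounded_linear
  bounded_linear_submod_closed.

Record bop := Bop { bop_fun :> H -> H ; bopP : bop_fun \in bounded_linear }.

HB.instance Definition _ := [isSub for bop_fun].
HB.instance Definition _ := [Choice of bop by <:].
HB.instance Definition _ := [SubChoice_isSubLmodule of bop by <:].

Definition opnorm (T : bop) : K :=
  supremum 0 [set `|T x| | x in [set x | `|x| <= 1]].

Lemma bop_linear (T : bop) : linear T.
Proof. by case: T => T /= /asboolP[]. Qed.

Lemma bop_bounded (T : bop) : exists M : K, forall x, `|T x| <= M * `|x|.
Proof. by case: T => T /= /asboolP[]. Qed.

Lemma bopD (S T : bop) x : (S + T) x = S x + T x. Proof. by []. Qed.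

Lemma bopN (T : bop) x : (- T) x = - T x. Proof. by []. Qed.

Lemma bopZ a (T : bop) x : (a *: T) x = a *: T x. Proof. by []. Qed.

Lemma bop0 (x : H) : (0 : bop) x = 0. Proof. by []. Qed.

Lemma bopZr (T : bop) a x : T (a *: x) = a *: T x.
Proof.
have T0 : T 0 = 0.
  by have := bop_linear T (-1) 0 0; rewrite !scaleN1r oppr0 addr0 addNr.
by have := bop_linear T a x 0; rewrite T0 !addr0.
Qed.

Lemma opnorm_sup (T : bop) :
  (forall x, `|x| <= 1 -> `|T x| <= opnorm T) /\
  (forall b : K, (forall x, `|x| <= 1 -> `|T x| <= b) -> opnorm T <= b).
Proof.
have [M TM] := bop_bounded T.
have Mge0 : 0 <= M \/ forall x : H, x = 0.
  have [[x x0]|/forallNP h] := pselect (exists x : H, x != 0).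
    left; have := le_trans (normr_ge0 _) (TM x).
    by rewrite pmulr_lge0 ?normr_gt0.
  by right=> x; apply/eqP; apply: contrapT => /negP/h.
have T1 x : `|x| <= 1 -> `|T x| <= `|M|.
  case: Mge0 => [M0 x1|H0 _].
    by rewrite (le_trans (TM x))// ger0_norm// ler_piMr.
  by rewrite (H0 (T x)) normr0.
have [|_ [x _ <-]//|_ [x /= x1 <-]|ub lub] := @supremum_scalar
  [set `|T x| | x in [set x | `|x| <= 1]] `|M|; last first.
- split=> [x x1|b Tb]; first by apply: ub; exists x.
  by apply: lub => _ [x x1 <-]; exact: Tb.
- exact: T1.
- by exists `|T 0|, 0 => //=; rewrite normr0.
Qed.

Lemma opnorm_ge0 T : 0 <= opnorm T.
Proof.
by rewrite (le_trans (normr_ge0 (T 0)))// (opnorm_sup T).1// normr0.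
Qed.

Lemma le_opnorm (T : bop) x : `|T x| <= opnorm T * `|x|.
Proof.
have [->|x0] := eqVneq x 0.
  by rewrite -(scale0r 0) bopZr !scale0r !normr0 mulr0.
have nx : 0 < `|x| by rewrite normr_gt0.
have := (opnorm_sup T).1 (`|x|^-1 *: x).
rewrite bopZr !normrZ normfV normr_id mulVf ?gt_eqF// => /(_ (lexx _)).
by rewrite ler_pdivrMl// mulrC.
Qed.

Lemma opnorm_le (T : bop) (c : K) : 0 <= c ->
  (forall x, `|T x| <= c * `|x|) -> opnorm T <= c.
Proof.
move=> c0 Tc; apply: (opnorm_sup T).2 => x x1.
by rewrite (le_trans (Tc x))// ler_piMr.
Qed.

Lemma opnormD S T : opnorm (S + T) <= opnorm S + opnorm T.
Proof.
apply: opnorm_le => [|x]; first by rewrite addr_ge0 ?opnorm_ge0.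
by rewrite bopD (le_trans (ler_normD _ _))// mulrDl lerD// le_opnorm.
Qed.

Lemma opnormZ a T : opnorm (a *: T) = `|a| * opnorm T.
Proof.
apply/eqP; rewrite eq_le; apply/andP; split.
  apply: opnorm_le => [|x]; first by rewrite mulr_ge0 ?opnorm_ge0.
  by rewrite bopZ normrZ -mulrA ler_wpM2l// le_opnorm.
have [->|a0] := eqVneq a 0; first by rewrite normr0 mul0r opnorm_ge0.
have na : 0 < `|a| by rewrite normr_gt0.
rewrite -ler_pdivlMl//; apply: opnorm_le => [|x].
  by rewrite mulr_ge0 ?invr_ge0 ?opnorm_ge0.
rewrite -mulrA ler_pdivlMl// -normrZ -bopZ; exact: le_opnorm.
Qed.

Lemma opnorm0_eq0 T : opnorm T = 0 -> T = 0.
Proof.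
move=> T0; apply/val_inj/funext => x /=; apply/eqP.
by rewrite -normr_le0 (le_trans (le_opnorm _ _))// T0 mul0r.
Qed.

HB.instance Definition _ :=
  Lmodule_isNormed.Build K bop opnormD opnormZ opnorm0_eq0.

(* T^{-1} is required to be bounded. *)
Definition invertible : set bop :=
  [set T : bop | exists S : bop, cancel T S /\ cancel S T].

Variable dot : {dot H for scalar_conj R k}.

(* The terms of the series are nonnegative reals, so that the convergence
   required here amounts to its sum being finite. *)
Definition is_frame (g : nat -> H) :=
  exists A B : K, [/\ 0 < A, 0 < B & forall f,
    let s := series (fun n => `|dot f (g n)| ^+ 2) in
    cvgn s /\ A * `|f| ^+ 2 <= limn s <= B * `|f| ^+ 2].

Definition frame_orbit_operators : set bop :=
  [set T : bop | exists phi : H, is_frame (fun n => iter n T phi)].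

End operators.
Arguments bop {R k} H.
Arguments invertible {R k} H.

(* Main.v *)
(* The frame condition only restricts the ambient set: the set of invertible
   operators is open in all of B(H). If S inverts T and |T - U| |S| <= 1/2, then
   x |-> x + S (y - U x) is a contraction whose fixed point solves U x = y, and
   |x| <= 2 |S| |U x| makes the resulting inverse of U bounded. *)
Require Import Defs.
From HB Require Import structures.
From mathcomp Require Import all_boot all_order all_algebra.
From mathcomp Require Import sesquilinear complex.
From mathcomp Require Import all_classical all_reals all_analysis.

Set Implicit Arguments.
Unset Strict Implicit.
Unset Printing Implicit Defensive.

Import Order.TTheory GRing.Theory Num.Theory.
Import numFieldNormedType.Exports.

Local Open Scope classical_set_scope.
Local Open Scope ring_scope.

(** A positive complex scalar has zero imaginary part, so both cases reduce to the archimedean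
    property of [R]. *)
Lemma scalar_half_exp_lt (R : realType) (k : scalar_kind)
    (e : scalar_field R k) :
  0 < e -> exists n, 2^-1 ^+ n < e.
Proof.
have real_case (r : R) : 0 < r -> exists n, 2^-1 ^+ n < r.
  (* This [n] exceeds [r^-1], and [n < 2 ^ n]. *)
  move=> r0; exists (Num.truncn r^-1).+1; rewrite exprVn.
  rewrite invf_plt ?posrE ?exprn_gt0//.
  rewrite (lt_trans (truncnS_gt _))// -natrX ltr_nat; exact: ltn_expl.
case: k e => e /=; first exact: real_case.
case: e => x y; rewrite ltcE/= => /andP[/eqP -> /real_case[n xn]].
exists n; have -> : (2^-1 : R[i]%C) ^+ n = (2^-1 ^+ n)%:C%C.
  by rewrite rmorphXn/= fmorphV/= rmorphMn/= rmorph1.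
by rewrite ltcR.
Qed.

(* [contraction] and [banach_fixed_point] of MathComp-Analysis require a
   [realType] of scalars, which excludes the complex numbers. *)
Lemma lipschitz_fixed_point (K : numFieldType) (V : completeNormedModType K)
    (q : K) (g : V -> V) :
  0 <= q -> q < 1 -> (forall e, 0 < e -> exists n, q ^+ n < e) ->
  (forall x y, `|g x - g y| <= q * `|x - y|) ->
  exists p, g p = p.
Proof.
move=> q0 q1 q_small gq.
(* Near-fixed points are close to each other, so the Cauchy property follows from small defects,
   without summing a geometric series. *)
have dist_defect x y : (1 - q) * `|x - y| <= `|x - g x| + `|y - g y|.
  rewrite mulrBl mul1r lerBlDr.
  have xyE : x - y = (x - g x) - (y - g y) + (g x - g y).
    by rewrite opprB addrACA addrA subrK addrAC addrA subrK addrC.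
  by rewrite {1}xyE (le_trans (ler_normD _ _))// lerD// ler_normB.
pose u n := iter n g 0.
pose d := `|u 0%N - u 1%N|.
have defect n : `|u n - g (u n)| <= q ^+ n * d.
  elim: n => [|n IH]; first by rewrite mul1r.
  by rewrite (le_trans (gq _ _))// exprS -mulrA ler_wpM2l.
have cu : cvgn u.
  apply/cauchy_cvgP/cauchy_exP => e e0.
  have d1 : 0 < d + 1 by rewrite ltr_wpDl ?normr_ge0.
  (* Chosen so that two defects of at most [q ^+ N * (d + 1)] add up to less than [(1 - q) * e];
     [d + 1] keeps the divisor positive when [d = 0]. *)
  have c0 : 0 < (1 - q) * e / (2 * (d + 1)).
    by rewrite divr_gt0 ?mulr_gt0 ?subr_gt0.
  have [N qN] := q_small _ c0.
  exists (u N), N => // n /= Nn; rewrite -ball_normE/=.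
  have q1' : 0 < 1 - q by rewrite subr_gt0.
  rewrite -(ltr_pM2l q1') (le_lt_trans (dist_defect _ _))//.
  have small m : (N <= m)%N -> `|u m - g (u m)| <= q ^+ N * (d + 1).
    move=> Nm; rewrite (le_trans (defect _))// ler_pM ?exprn_ge0 ?normr_ge0//.
      by rewrite ler_wiXn2l// ltW.
    by rewrite lerDl.
  rewrite (le_lt_trans (lerD (small _ (leqnn _)) (small _ Nn)))//.
  by rewrite -mulr2n -mulr_natl mulrCA -ltr_pdivlMr ?mulr_gt0.
(* The shifted sequence is also [g (u n)], so it tends both to [g (limn u)] and to [limn u]. *)
exists (limn u); apply/(@cvg_unique _ (@norm_hausdorff _ V) (u \o succn @ \oo)).
  apply/cvgrPdist_lt => e e0.
  move/cvgrPdist_lt : cu => /(_ _ e0) [N _ uN].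
  exists N => // n Nn; rewrite /= (le_lt_trans (gq _ _))//.
  by rewrite (le_lt_trans _ (uN _ Nn))// ler_piMl// ltW.
by rewrite -cvg_shiftS in cu.
Qed.

Section invertible_operators.
Context {R : realType} {k : scalar_kind}.
Local Notation K := (scalar_field R k).

Lemma bopDr (H : normedModType K) (T : bop H) x y : T (x + y) = T x + T y.
Proof. by have := bop_linear T 1 x y; rewrite !scale1r. Qed.

Lemma bopNr (H : normedModType K) (T : bop H) x : T (- x) = - T x.
Proof. by rewrite -scaleN1r bopZr scaleN1r. Qed.

(** The lower bound makes [U] injective, which forces the chosen right inverse to be linear and
    two-sided; [c] then bounds it. *)
Lemma invertible_bounded_below (H : normedModType K) (U : bop H) (c : K) :
  (forall y, exists x, U x = y) -> (forall x, `|x| <= c * `|U x|) ->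
  invertible H U.
Proof.
move=> /choice[W UW] Uc.
have injU : injective U.
  move=> x y Uxy; apply/eqP; rewrite -subr_eq0 -normr_le0.
  by rewrite (le_trans (Uc _))// bopDr bopNr Uxy subrr normr0 mulr0.
have bW : W \in @bounded_linear _ _ H.
  apply/asboolP; split=> [a x y|].
    by apply: injU; rewrite bopDr bopZr !UW.
  by exists c => x; rewrite (le_trans (Uc _))// UW.
by exists (Bop bW); split=> x //=; apply: injU; rewrite UW.
Qed.

Lemma invertible_perturbation (H : completeNormedModType K) (T S U : bop H) :
  cancel T S -> cancel S T ->
  opnorm S * opnorm (T - U) <= 2^-1 -> invertible H U.
Proof.
move=> TK SK near_TU.
have half01 : (0 <= 2^-1 :> K) /\ (2^-1 < 1 :> K).
  by rewrite invr_ge0 ler0n invf_lt1 ?ltr1n ?ltr0n.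
have SUE x : x - S (U x) = S ((T - U) x) by rewrite bopD bopN bopDr bopNr TK.
have SU_half x : `|x - S (U x)| <= 2^-1 * `|x|.
  rewrite SUE (le_trans (le_opnorm _ _))//.
  rewrite (le_trans (ler_wpM2l (opnorm_ge0 _) (le_opnorm _ _)))// mulrA.
  by rewrite ler_wpM2r.
apply: (@invertible_bounded_below _ _ (2 * opnorm S)) => [y|x].
  have [||e e0|x z|x] :=
      @lipschitz_fixed_point _ H 2^-1 (fun x => x + S (y - U x)).
  - exact: half01.1.
  - exact: half01.2.
  - exact: scalar_half_exp_lt.
  - have -> : x + S (y - U x) - (z + S (y - U z)) = x - z - S (U (x - z)).
      rewrite !bopDr !bopNr opprD addrACA; congr (_ + _).
      by rewrite !opprB addrC addrA subrK.
    exact: SU_half.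
  (* At a fixed point [S (y - U x) = 0], and applying [T] gives [y = U x]. *)
  - rewrite -[RHS]addr0 => /addrI Sx0; exists x; apply/eqP.
    rewrite eq_sym -subr_eq0 -[y - _]SK Sx0.
    by rewrite -(scale0r (0 : H)) bopZr !scale0r.
(* Absorbing the half on the left yields the constant [2 * opnorm S]. *)
have : `|x| <= 2^-1 * `|x| + opnorm S * `|U x|.
  rewrite -{1}(subrK (S (U x)) x) (le_trans (ler_normD _ _))//.
  by rewrite lerD// le_opnorm.
rewrite -lerBlDl -[X in X - _]mul1r -mulrBl.
have -> : 1 - 2^-1 = 2^-1 :> K by rewrite [X in X - _]splitr mul1r addrK.
by rewrite ler_pdivrMl ?ltr0n// mulrA.
Qed.

Lemma open_invertible (H : completeNormedModType K) :
  open (invertible H : set (bop H)).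
Proof.
rewrite openE => T [S [TK SK]]; rewrite /interior -nbhs_ballE.
have s0 : 0 < 1 + opnorm S by rewrite ltr_pwDl ?opnorm_ge0.
(* The summand 1 keeps the radius well defined when [opnorm S = 0], as on the zero space. *)
exists (2 * (1 + opnorm S))^-1; first by rewrite /= invr_gt0 mulr_gt0.
move=> U; rewrite -ball_normE/= => TU.
apply: (@invertible_perturbation _ T S) => //.
rewrite (le_trans (ler_wpM2l (opnorm_ge0 _) (ltW TU)))//.
rewrite invfM mulrCA ler_piMr ?invr_ge0// ler_pdivrMr// mul1r.
by rewrite lerDr.
Qed.

End invertible_operators.

Theorem proposition2p5 (R : realType) (k : scalar_kind)
    (H : completeNormedModType (scalar_field R k))
    (dot : {dot H for scalar_conj R k})
    (dot_norm : forall x : H, dot x x = `|x| ^+ 2)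
    (H_separable : separable H) :
  let E := frame_orbit_operators dot in
  open (E `&` invertible H : set (subspace E)).
Proof.
move=> E; apply/open_subspaceP; exists (invertible H).
  exact: open_invertible.
by rewrite setIC setIAC setIid.
Qed.
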